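(* Out of all rooted unordered binary trees $T$ of size $k$, the tree for which $\mathbb{P}(\mathrm{DTCS}(k)\cong T)$ is minimal is $\mathrm{Cat}^u(k)$. Moreover, for $k\ge 17$, $$\mathbb{P}(\mathrm{DTCS}(k)\cong\mathrm{Cat}^u(k))=\frac{k\,p^u_{\min}(16)}{16}\prod_{i=17}^k\frac{1}{h_{i-1}}=\exp\big(-(1+o(1))\,k\log\log k\big),$$ where the last equality is as $k\to\infty$.
   Context: Binary trees are rooted full binary trees: every internal vertex has exactly two children. The size of a tree is its number of leaves. Ordered trees (plane trees) are trees in which the left and right subtrees of each internal vertex are distinguished; $T\cong T'$ means identical as rooted unordered trees. For $m\ge 2$ let $h_{m-1}=\sum_{j=1}^{m-1}1/j$ and let $q_m$ be the probability distribution on $\{1,\dots,m-1\}$ given by $$q_m(i)=\frac{m}{2h_{m-1}}\,\frac{1}{i(m-i)}.$$ The discrete-time critical beta-splitting tree $\mathrm{DTCS}(n)$ is the random rooted ordered binary tree with $n$ leaves built as follows: split $[n]=\{1,\dots,n\}$ into a left subtree on $\{1,\dots,L_n\}$ and a right subtree on $\{L_n+1,\dots,n\}$, where $L_n$ has distribution $q_n$; then recursively and independently split each interval of size $m\ge2$ into left and right parts according to $q_m$, stopping at intervals of size $m=1$ (the leaves). Leaf labels are disregarded when comparing shapes. $p^u_{\min}(k)=\min_T\mathbb{P}(\mathrm{DTCS}(k)\cong T)$, the minimum being over all rooted unordered binary trees $T$ of size $k$. $\mathrm{CBT}(k)$ is the complete binary tree with $k$ leaves: every level is completely full except possibly the last,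 which is filled from the left. The unordered caterpillar tree $\mathrm{Cat}^u(k)$ is the following unordered binary tree of size $k$. $\mathrm{Cat}^u(1)$ is a single leaf; for $k\in\{4,8,16\}$, $\mathrm{Cat}^u(k)=\mathrm{CBT}(k)$; for every other $k\ge2$, the two root subtrees of $\mathrm{Cat}^u(k)$ are a single leaf and $\mathrm{Cat}^u(k-1)$. Thus for $5\le k\le7$ it is a spine of $k-4$ splits of size $1$ ending in a $\mathrm{CBT}(4)$, for $9\le k\le15$ a spine of $k-8$ splits of size $1$ ending in a $\mathrm{CBT}(8)$, and for $k\ge17$ a spine of $k-16$ splits of size $1$ ending in a $\mathrm{CBT}(16)$. $\log$ is the natural logarithm. *)

(* Defs.v *)
From HB Require Import structures.
From mathcomp Require Import all_boot all_order all_algebra.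
From mathcomp Require Import all_classical all_reals all_analysis.
From mathcomp Require Import zify ring lra.

Set Implicit Arguments.
Unset Strict Implicit.
Unset Printing Implicit Defensive.

Import Order.TTheory GRing.Theory Num.Theory.
Import numFieldNormedType.Exports.

Local Open Scope classical_set_scope.
Local Open Scope ring_scope.

(** * Full binary trees *)

(* Ordered (plane) full binary trees.  A rooted unordered binary tree is
   represented by any of its plane embeddings, up to [tree_iso]. *)
Inductive btree : Type := Leaf | Node (l r : btree).

Fixpoint leaves (t : btree) : nat :=
  if t is Node l r then (leaves l + leaves r)%N else 1%N.

Fixpoint tree_iso (t u : btree) : bool :=
  match t, u with
  | Leaf, Leaf => true
  | Node a b, Node c d =>
      tree_iso a c && tree_iso b d || tree_iso a d && tree_iso b c
  | _, _ => false
  end.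

(* The vertices of the complete binary tree with [k] leaves are numbered
   1, ..., 2k-1 level by level and from left to right, so that the children of
   the vertex [i] are [2i] and [2i+1]; the internal vertices are then those
   with [i < k].  [CBT_from d k i] is the subtree at the vertex [i], where [d]
   bounds its height. *)
Fixpoint CBT_from (d k i : nat) : btree :=
  if d is d'.+1 then
    if (i < k)%N then Node (CBT_from d' k i.*2) (CBT_from d' k i.*2.+1)
    else Leaf
  else Leaf.

Definition CBT (k : nat) : btree := CBT_from k k 1.

(* [Catu 0] is a dummy value. *)
Fixpoint Catu (k : nat) : btree :=
  match k with
  | 0 | 1 => Leaf
  | k'.+1 => if k \in [:: 4; 8; 16]%N then CBT k else Node Leaf (Catu k')
  end.

Fixpoint btree_encode (t : btree) : GenTree.tree unit :=
  if t is Node l r then GenTree.Node 0 [:: btree_encode l; btree_encode r]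
  else GenTree.Leaf tt.

Fixpoint btree_decode (t : GenTree.tree unit) : btree :=
  if t is GenTree.Node _ [:: l; r] then Node (btree_decode l) (btree_decode r)
  else Leaf.

Lemma btree_encodeK : cancel btree_encode btree_decode.
Proof. by elim => //= l -> r ->. Qed.

HB.instance Definition _ := Countable.copy btree (can_type btree_encodeK).
HB.instance Definition _ := isPointed.Build btree Leaf.
HB.instance Definition _ := @isMeasurable.Build default_measure_display
  btree discrete_measurable discrete_measurable0
  discrete_measurableC discrete_measurableU.

Definition node (p : btree * btree) : btree := Node p.1 p.2.

Lemma measurable_btree2 (A : set (btree * btree)) : measurable A.
Proof.
apply: countable_measurable => [[x y]|]; last exact: countableP.
rewrite (_ : [set (x, y)] = [set x] `*` [set y]); first exact: measurableX.
by apply/seteqP; split => [_ ->//|[a b] [/= -> ->]].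
Qed.

Lemma measurable_node : measurable_fun setT node.
Proof. by move=> _ A _; exact: measurable_btree2. Qed.

(** * The critical beta-splitting distribution *)

Section splitting.
Context (R : realType).

Definition harm (m : nat) : R := \sum_(1 <= j < m.+1) j%:R^-1.

Definition splitq (m i : nat) : R :=
  m%:R / (2 * harm m.-1) * (i%:R * (m - i)%:R)^-1.

Lemma harm_ge0 m : 0 <= harm m.
Proof. by apply: sumr_ge0 => j _; rewrite invr_ge0. Qed.

Lemma harm_gt0 m : (0 < m)%N -> 0 < harm m.
Proof.
case: m => // m _; rewrite /harm big_nat_recl//= ltr_wpDr ?invr1//.
by apply: sumr_ge0 => j _; rewrite invr_ge0.
Qed.

Lemma splitq_ge0 m i : 0 <= splitq m i.
Proof.
by rewrite /splitq mulr_ge0 ?divr_ge0 ?invr_ge0 ?mulr_ge0// harm_ge0.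
Qed.

Lemma sum_splitq m : (1 < m)%N -> \sum_(1 <= i < m) splitq m i = 1.
Proof.
case: m => [//|m]; rewrite ltnS => m0; rewrite /splitq -mulr_sumr/=.
have h0 : harm m != 0 by rewrite gt_eqF// harm_gt0.
have -> : \sum_(1 <= i < m.+1) (i%:R * (m.+1 - i)%:R)^-1 =
          \sum_(1 <= i < m.+1) m.+1%:R^-1 * (i%:R^-1 + (m.+1 - i)%:R^-1) :> R.
  apply: eq_big_nat => i /andP[i0 im].
  have a0 : i%:R != 0 :> R by rewrite pnatr_eq0 -lt0n.
  have b0 : (m.+1 - i)%:R != 0 :> R by rewrite pnatr_eq0 subn_eq0 -ltnNge.
  have -> : m.+1%:R = i%:R + (m.+1 - i)%:R :> R by rewrite -natrD subnKC// ltnW.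
  field; rewrite a0 b0/= -natrD subnKC ?pnatr_eq0//; exact: ltnW.
rewrite -mulr_sumr big_split/=.
have -> : \sum_(1 <= i < m.+1) (m.+1 - i)%:R^-1 = harm m :> R.
  rewrite big_nat_rev/=; apply: eq_big_nat => i /andP[i0 im].
  by congr (_%:R^-1); lia.
rewrite -/(harm m).
have m1 : m.+1%:R != 0 :> R by rewrite pnatr_eq0.
by move: (m.+1%:R : R) m1 => c c0; field; rewrite h0 c0.
Qed.

(** * The law of DTCS(n) *)

(* Law of [Node L R] for independent [L] and [R] of laws [mu] and [nu]. *)
Definition node_law (mu nu : set btree -> \bar R) : set btree -> \bar R :=
  pushforward (mu \x nu)%E node.

Section node_law_probability.
Variables mu nu : probability btree R.

Let node_law0 : node_law mu nu set0 = 0%E.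
Proof. by rewrite /node_law /pushforward preimage_set0 measure0. Qed.

Let node_law_ge0 A : (0 <= node_law mu nu A)%E.
Proof. by rewrite /node_law /pushforward; exact: measure_ge0. Qed.

Let node_law_sigma_additive : semi_sigma_additive (node_law mu nu).
Proof.
move=> F mF tF mUF; rewrite /node_law /pushforward preimage_bigcup.
apply: measure_semi_sigma_additive.
- by move=> n; exact: measurable_btree2.
- apply/trivIsetP => /= i j _ _ ij; rewrite -preimage_setI.
  by move/trivIsetP : tF => /(_ _ _ _ _ ij) ->//; rewrite preimage_set0.
- exact: measurable_btree2.
Qed.

HB.instance Definition _ := isMeasure.Build _ _ _ (node_law mu nu)
  node_law0 node_law_ge0 node_law_sigma_additive.

Lemma node_law_setT : node_law mu nu setT = 1%E.
Proof.
rewrite /node_law /pushforward preimage_setT -setXTT product_measure1E//.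
by rewrite /= !probability_setT mule1.
Qed.

End node_law_probability.

(* [dtcs n] is the law of DTCS(n): for [n >= 2] the left part has size [i] with
   probability [splitq n i] and, given [i], the two subtrees are independent
   with the laws for the sizes [i] and [n - i] (lemma [dtcsE]).  The first
   argument of [dtcs_rec] is fuel, and [n = 0] is a dummy case. *)
Fixpoint dtcs_rec (s n : nat) : set btree -> \bar R :=
  if s is s'.+1 then
    if (n <= 1)%N then \d_Leaf
    else fun A => (\sum_(1 <= i < n) (splitq n i)%:E *
      node_law (dtcs_rec s' i) (dtcs_rec s' (n - i)) A)%E
  else \d_Leaf.

Definition dtcs (n : nat) : set btree -> \bar R := dtcs_rec n n.

Lemma dtcs_recE s n : (n <= s)%N -> dtcs_rec s n = dtcs n.
Proof.
rewrite /dtcs; move: {-2}n (leqnn n) => m; elim: n m s => [|n IH] m s.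
  by rewrite leqn0 => /eqP ->; case: s.
case: m => [|m]; first by case: s.
case: s => [//|s]; rewrite ltnS => mn; rewrite ltnS => ms /=.
case: ifPn => // m1; apply/funext => A; apply: eq_big_nat => i /andP[i0 im].
have -> : dtcs_rec s i = dtcs_rec m i.
  by rewrite (IH i s) ?(IH i m)//; lia.
have -> // : dtcs_rec s (m.+1 - i) = dtcs_rec m (m.+1 - i).
by rewrite (IH _ s) ?(IH _ m)//; lia.
Qed.

Lemma dtcs1 : dtcs 1 = \d_Leaf.
Proof. by []. Qed.

Lemma dtcsE n A : (1 < n)%N ->
  dtcs n A = (\sum_(1 <= i < n) (splitq n i)%:E *
              node_law (dtcs i) (dtcs (n - i)) A)%E.
Proof.
case: n => [//|n] n1; rewrite {1}/dtcs /= leqNgt n1/=.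
apply: eq_big_nat => i /andP[i0 im].
by rewrite !dtcs_recE//; lia.
Qed.

Lemma dtcs_probability n : exists P : probability btree R, dtcs n = P.
Proof.
elim/ltn_ind: n => n IH.
have [n1|n1] := leqP n 1.
  by exists \d_Leaf; move: n n1 {IH} => [|[|]].
have /choice[P PE] (i : nat) :
    exists P : probability btree R, (i < n)%N -> dtcs i = P.
  case: (ltnP i n) => [/IH[P ->]|_]; first by exists P.
  by exists \d_Leaf.
pose M (i : nat) : {measure set btree -> \bar R} :=
  mscale (NngNum (splitq_ge0 n i.+1)) (node_law (P i.+1) (P (n - i.+1)%N)).
have ME : dtcs n = msum M n.-1.
  apply/funext => A; rewrite dtcsE// /msum big_add1 big_mkord.
  apply: eq_bigr => i _; rewrite /M/= /mscale/=.
  by have := ltn_ord i => im; rewrite !PE//; lia.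
have MT : msum M n.-1 setT = 1%E.
  rewrite /msum -[RHS](_ : (\sum_(1 <= i < n) splitq n i)%:E = _); last first.
    by rewrite sum_splitq.
  rewrite big_add1 big_mkord -sumEFin; apply: eq_bigr => i _.
  by rewrite /M/= /mscale/= node_law_setT mule1.
pose Q : probability btree R :=
  HB.pack_for (probability btree R) (msum M n.-1)
    (Measure_isProbability.Build _ _ _ (msum M n.-1) MT).
by exists Q.
Qed.

Let dtcs0 n : dtcs n set0 = 0%E.
Proof. by have [P ->] := dtcs_probability n; exact: measure0. Qed.

Let dtcs_ge0 n A : (0 <= dtcs n A)%E.
Proof. by have [P ->] := dtcs_probability n; exact: measure_ge0. Qed.

Let dtcs_sigma_additive n : semi_sigma_additive (dtcs n).
Proof.
by have [P ->] := dtcs_probability n; exact: measure_semi_sigma_additive.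
Qed.

HB.instance Definition _ n := isMeasure.Build _ _ _ (dtcs n)
  (dtcs0 n) (@dtcs_ge0 n) (@dtcs_sigma_additive n).

Let dtcs_setT n : dtcs n setT = 1%E.
Proof. by have [P ->] := dtcs_probability n; exact: probability_setT. Qed.

HB.instance Definition _ n :=
  Measure_isProbability.Build _ _ _ (dtcs n) (dtcs_setT n).

(* The probability that DTCS(k) and [T] are isomorphic as unordered trees. *)
Definition Piso (k : nat) (T : btree) : R :=
  fine (dtcs k [set t | tree_iso t T]).

(* The infimum is attained, see [pmin_attained]. *)
Definition pmin (k : nat) : R :=
  inf [set Piso k T | T in [set T | leaves T = k]].

Let trees (s : nat) : seq btree :=
  iter s (fun ts => Leaf :: [seq Node l r | l <- ts, r <- ts]) [::].

Let mem_trees s T : (leaves T <= s)%N -> T \in trees s.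
Proof.
have leaves_gt0 t : (0 < leaves t)%N.
  by elim: t => //= l l0 r r0; rewrite addn_gt0 l0.
elim: s T => [|s IH] [|l r] /=; rewrite ?in_cons//.
- by rewrite leqNgt (leq_trans (leaves_gt0 l))// leq_addr.
- move=> lrs; apply: allpairs_f; apply: IH.
  + by have := leaves_gt0 r; lia.
  + by have := leaves_gt0 l; lia.
Qed.

Lemma pmin_attained k : (0 < k)%N -> exists2 T, leaves T = k &
  pmin k = Piso k T /\ forall U, leaves U = k -> Piso k T <= Piso k U.
Proof.
move=> k0.
have [T0 T0k] : exists T, leaves T = k.
  case: k k0 => // k _; elim: k => [|k [T Tk]]; first by exists Leaf.
  by exists (Node Leaf T); rewrite /= Tk.
pose ts := [seq T <- trees k | leaves T == k].
have tsE T : (T \in ts) = (leaves T == k).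
  rewrite mem_filter; case: eqP => //= Tk.
  by rewrite mem_trees// Tk.
have [T Tts Tmin] : exists2 T, T \in ts &
    forall U, U \in ts -> Piso k T <= Piso k U.
  have: T0 \in ts by rewrite tsE T0k.
  elim: ts T0 {tsE T0k} => // T ts IH T0 _.
  case: ts IH => [_|V ts /(_ V (mem_head _ _))[W Wts Wmin]].
    by exists T; rewrite ?mem_head// => U; rewrite mem_seq1 => /eqP ->.
  have [TW|WT] := leP (Piso k T) (Piso k W).
    exists T; rewrite ?mem_head// => U; rewrite in_cons => /predU1P[->//|].
    by move=> /Wmin; exact: le_trans.
  exists W; first by rewrite in_cons Wts orbT.
  by move=> U; rewrite in_cons => /predU1P[->|/Wmin//]; exact: ltW.
have {}Tmin U : leaves U = k -> Piso k T <= Piso k U.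
  by move=> Uk; apply: Tmin; rewrite tsE Uk.
have Tk : leaves T = k by apply/eqP; rewrite -tsE.
exists T => //; split => //; apply/eqP; rewrite eq_le; apply/andP; split.
  apply: ge_inf; last by exists T.
  by exists (Piso k T) => _ [U Uk <-]; exact: Tmin.
apply: lb_le_inf; first by exists (Piso k T), T.
by move=> _ [U Uk <-]; exact: Tmin.
Qed.

End splitting.

(* Main.v *)
(* Unfolding the splitting probabilities, the factors m / (i (m - i)) telescope:
   P(DTCS(k) ~ T) = k / weight T, where weight T is the product of h_{|v|-1}
   over the internal vertices v, with an extra factor 2 for each v whose two
   subtrees are isomorphic.  So one maximises the weight, by strong induction on
   the size.  Writing G(k) for the weight of the caterpillar, the point is that
   G(i) G(k-i) < G(k-1) for 2 <= i <= k-i, even with the symmetry factor 2 when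
   i = k-i, unless k is 4, 8 or 16.  For k <= 16 this is a computation; for
   k >= 17, moving leaves from the smaller side to the larger one increases
   G(i) G(j) until i is 2, 4, 8 or 16, and then G(i) is beaten by the i - 1
   harmonic factors gained by moving i - 1 leaves to the other side.
   For the asymptotics, log h_k = log log k + O(1) summed over the spine gives
   log G(k) = k log log k + O(k). *)

Require Import Defs.
From HB Require Import structures.
From mathcomp Require Import all_boot all_order all_algebra.
From mathcomp Require Import all_classical all_reals all_analysis.
From Stdlib Require NArith.
From mathcomp Require Import zify ring lra.

Set Implicit Arguments.
Unset Strict Implicit.
Unset Printing Implicit Defensive.

Import Order.TTheory GRing.Theory Num.Theory.
Import numFieldNormedType.Exports.

Local Open Scope classical_set_scope.
Local Open Scope ring_scope.

(** * Unordered isomorphism as a size-preserving equivalence *)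

Lemma leaves_gt0 t : (0 < leaves t)%N.
Proof. by elim: t => //= l l0 r r0; rewrite addn_gt0 l0. Qed.

Lemma tree_iso_refl t : tree_iso t t.
Proof. by elim: t => //= l -> r ->. Qed.

Lemma tree_iso_sym t u : tree_iso t u = tree_iso u t.
Proof.
elim: t u => [|a IHa b IHb] [|c d] //=.
by rewrite !IHa !IHb [tree_iso d a && _]andbC.
Qed.

Lemma tree_iso_trans t u v : tree_iso t u -> tree_iso u v -> tree_iso t v.
Proof.
elim: t u v => [|a IHa b IHb] [|c d] [|e f] //=.
move=> /orP[]/andP[/IHa ha /IHb hb] /orP[]/andP[hc hd].
- by rewrite (ha _ hc) (hb _ hd).
- by rewrite (ha _ hc) (hb _ hd) orbT.
- by rewrite (ha _ hd) (hb _ hc) orbT.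
- by rewrite (ha _ hd) (hb _ hc).
Qed.

Lemma tree_iso_leaves t u : tree_iso t u -> leaves t = leaves u.
Proof.
elim: t u => [|a IHa b IHb] [|c d] //= /orP[]/andP[/IHa -> /IHb ->] //.
exact: addnC.
Qed.

(** * The weight of a tree *)

Section weight.
Context (R : realType).

Fixpoint weight (t : btree) : R :=
  if t is Node a b then
    (if tree_iso a b then 2 else 1) * harm R (leaves t).-1 *
    (weight a * weight b)
  else 1.

Lemma weight_gt0 t : 0 < weight t.
Proof.
elim: t => [|a IHa b IHb]; first exact: ltr01.
rewrite /= !mulr_gt0//; first by case: ifP.
by apply: harm_gt0; have := leaves_gt0 a; have := leaves_gt0 b; lia.
Qed.

Lemma node_law_setX (i j : nat) (A B : set btree) (S : set btree) :
  node @^-1` S = A `*` B ->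
  node_law (dtcs R i) (dtcs R j) S = (dtcs R i A * dtcs R j B)%E.
Proof.
move=> SE; rewrite /node_law /pushforward SE.
exact: (product_measure1E (dtcs R i) (dtcs R j)).
Qed.

(** Serves non-isomorphic subtrees: their two orders give disjoint rectangles, whose product
    measures add. *)
Lemma node_law_setXU (i j : nat) (A B : set btree) (S : set btree) :
  A `&` B = set0 -> node @^-1` S = (A `*` B) `|` (B `*` A) ->
  node_law (dtcs R i) (dtcs R j) S =
  (dtcs R i A * dtcs R j B + dtcs R i B * dtcs R j A)%E.
Proof.
move=> AB SE; rewrite /node_law /pushforward SE.
rewrite (measureU (dtcs R i \x dtcs R j)%E).
- by congr (_ + _)%E; exact: (product_measure1E (dtcs R i) (dtcs R j)).
- exact: measurable_btree2.
- exact: measurable_btree2.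
- apply/seteqP; split => // -[x y] [[/= Ax _] [/= Bx _]].
  by have : (A `&` B) x by []; rewrite AB.
Qed.

(** Non-isomorphic subtrees occur in two orders, which absorbs the 2 in the denominator of [splitq];
    isomorphic ones leave it in [weight]. The zero case for wrong sizes lets the induction
    hypotheses apply at every [i] of the sum. *)
Lemma dtcs_iso T k : (0 < k)%N ->
  dtcs R k [set t | tree_iso t T] =
  (if leaves T == k then k%:R / weight T else 0)%:E.
Proof.
elim: T k => [|A IHA B IHB] k k0.
  case: k k0 => [|[|k]]// _.
    by rewrite dtcs1/= diracE mem_set//= divr1.
  rewrite dtcsE//= big1// => i _.
  rewrite (@node_law_setX _ _ set0 set0) ?measure0 ?mul0e ?mule0//.
  by apply/seteqP; split => -[x y] [].
have LA := leaves_gt0 A; have LB := leaves_gt0 B.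
case: (ltnP 1 k) => k1; last first.
  have -> : k = 1%N by lia.
  rewrite dtcs1/= diracE memNset//= ifF//; lia.
rewrite dtcsE//=.
pose p i T' : R := if leaves T' == i then i%:R / weight T' else 0.
pose S : set btree := [set t | tree_iso t (Node A B)].
have measE i : (0 < i < k)%N ->
    node_law (dtcs R i) (dtcs R (k - i)) S =
    (p i A * p (k - i)%N B +
     (if tree_iso A B then 0 else p i B * p (k - i)%N A))%:E.
  move=> ik.
  have kik : (0 < k - i)%N by lia.
  case: ifPn => [AB|AB].
    rewrite (@node_law_setX _ _ [set t | tree_iso t A] [set t | tree_iso t B]).
      by rewrite IHA ?IHB ?addr0//; lia.
    apply/seteqP; split => -[x y] /=; last first.
      by move=> [xA yB]; apply/orP; left; apply/andP.
    move=> /orP[/andP[]//|/andP[xB yA]]; split.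
      by apply: tree_iso_trans xB _; rewrite tree_iso_sym.
    exact: tree_iso_trans yA AB.
  rewrite (@node_law_setXU _ _ [set t | tree_iso t A] [set t | tree_iso t B]).
  - by rewrite !IHA ?IHB//; lia.
  - apply/seteqP; split => // x [/= xA xB]; move/negP: AB; apply.
    by apply: tree_iso_trans xB; rewrite tree_iso_sym.
  - apply/seteqP; split => -[x y] /=.
      by move=> /orP[/andP[]|/andP[]]; [left|right].
    by move=> [[xA yB]|[xB yA]]; apply/orP; [left|right]; apply/andP.
have -> : (\sum_(1 <= i < k)
    (splitq R k i)%:E * node_law (dtcs R i) (dtcs R (k - i)) S =
  \sum_(1 <= i < k) (splitq R k i *
    (p i A * p (k - i)%N B +
     (if tree_iso A B then 0 else p i B * p (k - i)%N A)))%:E)%E.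
  by apply: eq_big_nat => i ik; rewrite measE.
rewrite sumEFin; congr (_%:E).
(* Only [i = leaves A'] contributes, and there the numerators of the two subtree probabilities
   cancel the denominator [i (k - i)] of [splitq]. *)
have sum_pp A' B' : (0 < leaves A')%N -> (0 < leaves B')%N ->
    \sum_(1 <= i < k) splitq R k i * (p i A' * p (k - i)%N B') =
    if (leaves A' + leaves B' == k)%N then
      k%:R / (2 * harm R k.-1) / (weight A' * weight B') else 0.
  move=> A0 B0; case: ifPn => [/eqP kE|kE].
    have -> : k%:R / (2 * harm R k.-1) / (weight A' * weight B') =
        splitq R k (leaves A') * (p (leaves A') A' * p (k - leaves A')%N B').
      rewrite /p eqxx /splitq.
      have -> : (k - leaves A' = leaves B')%N by lia.
      rewrite eqxx.
      have a0 : (leaves A')%:R != 0 :> R by rewrite pnatr_eq0 -lt0n.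
      have b0 : (leaves B')%:R != 0 :> R by rewrite pnatr_eq0 -lt0n.
      field; rewrite a0 b0 !gt_eqF ?weight_gt0 ?harm_gt0//; lia.
    rewrite (bigD1_seq (leaves A')) ?iota_uniq//=; last first.
      by rewrite mem_index_iota; lia.
    rewrite big1 ?addr0// => i iA.
    by rewrite /p eq_sym (negbTE iA) mul0r mulr0.
  rewrite big_nat big1// => i ik; rewrite /p.
  case: eqP => [iA|]; last by rewrite mul0r mulr0.
  by case: eqP => [iB|]; [lia|rewrite !mulr0].
have hk : harm R k.-1 != 0 by rewrite gt_eqF ?harm_gt0//; lia.
have wA := gt_eqF (weight_gt0 A); have wB := gt_eqF (weight_gt0 B).
case: (boolP (tree_iso A B)) => AB /=.
  under eq_bigr do rewrite addr0.
  rewrite sum_pp//; case: ifP => // /eqP ->.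
  by field; rewrite wA wB hk.
under eq_bigr do rewrite mulrDr.
rewrite big_split/= !sum_pp// [X in _ + (if X == _ then _ else _)]addnC.
case: ifP => [/eqP ->|]; last by rewrite addr0.
by field; rewrite wA wB hk.
Qed.

Lemma PisoE T : Piso R (leaves T) T = (leaves T)%:R / weight T.
Proof. by rewrite /Piso dtcs_iso ?leaves_gt0// eqxx. Qed.

End weight.

(** * Weights of caterpillars *)

Section caterpillar.
Context (R : realType).
Local Notation h := (harm R).
Local Notation w := (@weight R).
Local Notation G k := (weight R (Catu k)).
Local Notation special := ([:: 4; 8; 16]%N).
Local Notation anchors :=
  ([:: (1, 2, 15); (1, 4, 13); (1, 8, 9); (2, 8, 10); (2, 16, 16)]%N).
Local Notation Nadd := BinNat.N.add.
Local Notation Nmul := BinNat.N.mul.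
Local Notation Ndiv := BinNat.N.div.
Local Notation Nlcm := BinNat.N.lcm.
Local Notation Nltb := BinNat.N.ltb.
Local Notation Neqb := BinNat.N.eqb.
Local Notation Nof := BinNat.N.of_nat.

Lemma Catu_spine k : (1 < k)%N -> k.+1 \notin special ->
  Catu k.+1 = Node Leaf (Catu k).
Proof. by case: k => [|k]// _ /= /negbTE ->. Qed.

Lemma Catu_bal k : k \in special -> Catu k = Node (Catu k./2) (Catu k./2).
Proof. by rewrite !inE => /or3P[]/eqP ->; vm_compute. Qed.

Lemma leaves_Catu k : (0 < k)%N -> leaves (Catu k) = k.
Proof.
elim: k => [//|[//|k] IH] _.
have [ks|ks] := boolP (k.+2 \in special).
  by move: ks; rewrite !inE => /or3P[]/eqP ->; vm_compute.
by have := IH isT; rewrite /= (negbTE ks) /= => ->.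
Qed.

Lemma weight_spine k : (1 < k)%N -> k.+1 \notin special -> G k.+1 = h k * G k.
Proof.
move=> k1 ks; rewrite Catu_spine//.
rewrite -[LHS]/((if tree_iso Leaf (Catu k) then 2 else 1) *
  h (1 + leaves (Catu k))%N.-1 * (1 * G k)).
rewrite leaves_Catu ?(ltnW k1)//= ifF ?mul1r//.
have := leaves_Catu (ltnW k1); case: (Catu k) => //= kE.
by rewrite -kE in k1.
Qed.

Lemma weight_bal k : k \in special -> G k = 2 * h k.-1 * (G k./2 * G k./2).
Proof.
move=> ks; rewrite Catu_bal//= tree_iso_refl leaves_Catu; last first.
  by move: ks; rewrite !inE => /or3P[]/eqP ->.
by move: ks; rewrite !inE => /or3P[]/eqP ->.
Qed.

Lemma harm_le m n : (m <= n)%N -> h m <= h n.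
Proof.
move=> mn; rewrite /harm [leRHS](@big_cat_nat _ _ _ m.+1)//= lerDl.
by apply: sumr_ge0 => j _; rewrite invr_ge0.
Qed.

(* [harm m * scale] is an integer for [m <= 30], so the comparisons between
   small caterpillars become computations on binary integers. *)
Definition scale : BinNums.N :=
  foldr (fun j => Nlcm (Nof j)) (Nof 1) (iota 1 30).

Definition harmN (m : nat) : BinNums.N :=
  foldr (fun j => Nadd (Ndiv scale (Nof j))) BinNums.N0 (iota 1 m).

Fixpoint weightN (t : btree) : BinNums.N :=
  if t is Node a b then
    Nmul (Nmul (Nof (if tree_iso a b then 2 else 1)) (harmN (leaves t).-1))
         (Nmul (weightN a) (weightN b))
  else Nof 1.

Definition NR (n : BinNums.N) : R := (BinNat.N.to_nat n)%:R.

Lemma NRD a b : NR (Nadd a b) = NR a + NR b.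
Proof. by rewrite /NR Nnat.N2Nat.inj_add natrD. Qed.

Lemma NRM a b : NR (Nmul a b) = NR a * NR b.
Proof. by rewrite /NR Nnat.N2Nat.inj_mul natrM. Qed.

Lemma NR_nat n : NR (Nof n) = n%:R.
Proof. by rewrite /NR Nnat.Nat2N.id. Qed.

Lemma NR_lt a b : Nltb a b -> NR a < NR b.
Proof. move=> /BinNat.N.ltb_lt ab; rewrite /NR ltr_nat; lia. Qed.

(* Locked to keep unification from evaluating [scale] in unary. *)
Definition scaleR : R := locked (NR scale).

Lemma scaleR_gt0 : 0 < scaleR.
Proof.
rewrite /scaleR -lock -[X in X < _]/(NR BinNums.N0).
by apply: NR_lt; vm_compute.
Qed.

(** The exponent [d] counts harmonic factors, each cleared by one [scaleR]; reals with equal [d]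
    then compare as integers. *)
Definition scaled (x : R) (d : nat) (n : BinNums.N) := x * scaleR ^+ d = NR n.

Lemma scaled_nat n : scaled n%:R 0 (Nof n).
Proof. by rewrite /scaled mulr1 NR_nat. Qed.

Lemma scaledM x d n y e m :
  scaled x d n -> scaled y e m -> scaled (x * y) (d + e) (Nmul n m).
Proof. by rewrite /scaled NRM exprD mulrACA => -> ->. Qed.

Lemma scaled_lt x y d n m :
  scaled x d n -> scaled y d m -> Nltb n m -> x < y.
Proof.
rewrite /scaled => xn ym /NR_lt; rewrite -xn -ym ltr_pM2r//.
by rewrite exprn_gt0// scaleR_gt0.
Qed.

Lemma scaled_harm m : (m <= 30)%N -> scaled (h m) 1 (harmN m).
Proof.
rewrite /scaled expr1 /harmN /harm /index_iota subn1 /= => m30.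
(* The division in [harmN] is exact because every [j] up to 30 divides [scale], which is checked by
   evaluation. *)
have dvd j : j \in iota 1 m -> j%:R^-1 * scaleR =
    NR (Ndiv scale (Nof j)).
  rewrite mem_iota => jm.
  have /allP/(_ j) :
      all (fun j => Neqb (Nmul (Nof j) (Ndiv scale (Nof j))) scale) (iota 1 30).
    by vm_compute.
  rewrite mem_iota => /(_ ltac:(lia)) /BinNat.N.eqb_eq E.
  have -> : scaleR = j%:R * NR (Ndiv scale (Nof j)).
    by rewrite /scaleR -lock -NR_nat -NRM; congr (NR _).
  apply: mulKf; rewrite pnatr_eq0; clear -jm; lia.
elim: (iota 1 m) dvd => [|j s IH] dvd; first by rewrite big_nil mul0r.
rewrite big_cons -[foldr _ _ _]/(Nadd _ (foldr _ _ s)) NRD mulrDl.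
rewrite dvd ?mem_head ?IH// => i si.
by apply: dvd; rewrite in_cons si orbT.
Qed.

(** A full binary tree has one internal vertex fewer than leaves, and each brings one harmonic
    number; hence the exponent. *)
Lemma scaled_weight t : (leaves t <= 31)%N ->
  scaled (w t) (leaves t).-1 (weightN t).
Proof.
elim: t => [|a IHa b IHb]; first by move=> _; exact: (scaled_nat 1).
rewrite [leaves _]/= [weight _ _]/= => ab.
have a0 := leaves_gt0 a; have b0 := leaves_gt0 b.
rewrite [X in scaled _ X]
  (_ : _ = 0 + 1 + ((leaves a).-1 + (leaves b).-1))%N; last by lia.
apply: scaledM; last by apply: scaledM; [apply: IHa|apply: IHb]; lia.
apply: scaledM; last by apply: scaled_harm; lia.
have -> : (if tree_iso a b then 2 else 1) =
  (if tree_iso a b then 2 else 1)%N%:R :> R by case: ifP.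
exact: scaled_nat.
Qed.

Lemma scaled_Catu k : (0 < k <= 31)%N -> scaled (G k) k.-1 (weightN (Catu k)).
Proof.
move=> /andP[k0 k31]; rewrite -[X in scaled _ X.-1 _](leaves_Catu k0).
by apply: scaled_weight; rewrite leaves_Catu.
Qed.

(** * Comparisons of splits at small sizes, decided by evaluation *)

Definition sym (i j : nat) : nat := if i == j then 2 else 1.

Lemma weight_gap_small i j : (1 < i <= j)%N -> (i + j <= 16)%N ->
  (i + j)%N \notin special ->
  (sym i j)%:R * (G i * G j) < G (i + j).-1.
Proof.
move=> ij k16 ks.
apply: (@scaled_lt _ _ (0 + (i.-1 + j.-1))
  (Nmul (Nof (sym i j)) (Nmul (weightN (Catu i)) (weightN (Catu j))))
  (weightN (Catu (i + j).-1))).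
- apply: scaledM; first exact: scaled_nat.
  by apply: scaledM; apply: scaled_Catu; lia.
- have -> : (0 + (i.-1 + j.-1) = (i + j).-1.-1)%N by lia.
  by apply: scaled_Catu; lia.
- have /allP/(_ (i + j)%N) : all (fun k => (k \notin special) ==>
    all (fun i => Nltb (Nmul (Nof (sym i (k - i)))
       (Nmul (weightN (Catu i)) (weightN (Catu (k - i)))))
       (weightN (Catu k.-1))) (iota 2 k./2.-1)) (iota 4 13).
    by vm_compute.
  rewrite mem_iota => /(_ ltac:(lia)); rewrite ks => /allP/(_ i).
  rewrite mem_iota addKn; apply; lia.
Qed.

(** At sizes 4, 8 and 16 the symmetric split beats every unequal one; the root factor [h k.-1],
    common to both sides, is left out. *)
Lemma weight_gap_bal i j : (0 < i < j)%N -> (i + j)%N \in special ->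
  G i * G j < 2 * (G (i + j)./2 * G (i + j)./2).
Proof.
move=> ij ks; set m := (i + j)./2.
have m8 : (m <= 8)%N by move: ks; rewrite !inE /m; lia.
have kE : (i + j = m + m)%N by move: ks; rewrite !inE /m; lia.
apply: (@scaled_lt _ _ (0 + (m.-1 + m.-1))
  (Nmul (weightN (Catu i)) (weightN (Catu j)))
  (Nmul (Nof 2) (Nmul (weightN (Catu m)) (weightN (Catu m))))).
- have -> : (0 + (m.-1 + m.-1) = i.-1 + j.-1)%N by lia.
  by apply: scaledM; apply: scaled_Catu; lia.
- apply: scaledM; first exact: scaled_nat.
  by apply: scaledM; apply: scaled_Catu; lia.
- have /allP/(_ (i + j)%N ks) : all (fun k =>
    all (fun i => Nltb
       (Nmul (weightN (Catu i)) (weightN (Catu (k - i))))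
       (Nmul (Nof 2)
         (Nmul (weightN (Catu k./2)) (weightN (Catu k./2)))))
       (iota 1 k./2.-1)) special.
    by vm_compute.
  move=> /allP/(_ i); rewrite mem_iota addKn; apply; lia.
Qed.

(* An entry [(c, s, j)] of [anchors]: a subtree of size [s] is not worth
   splitting off when the other one has size at least [j], even if symmetry
   contributes a factor [c]. *)
Lemma weight_anchor c s j : (c, s, j) \in anchors ->
  c%:R * G s < \prod_(l < s.-1) h (j + l).
Proof.
move=> csj.
have sc n : (j + n <= 31)%N -> scaled (\prod_(l < n) h (j + l)) n
    (foldl (fun x l => Nmul x (harmN (j + l))) (Nof 1) (iota 0 n)).
  elim: n => [|n IH] jn; first by rewrite big_ord0; exact: (scaled_nat 1).
  have -> : iota 0 n.+1 = iota 0 n ++ [:: n] by rewrite -addn1 iotaD.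
  rewrite big_ord_recr foldl_cat [X in scaled _ X](esym (addn1 n)).
  by apply: scaledM; [apply: IH|apply: (@scaled_harm (j + n))]; lia.
apply: (@scaled_lt _ _ (0 + s.-1) _ _ _ (sc _ _)).
- apply: scaledM; first exact: scaled_nat.
  apply: scaled_Catu.
  by move: csj; rewrite !inE !xpair_eqE; lia.
- by move: csj; rewrite !inE !xpair_eqE; lia.
- move: csj; rewrite !inE.
  by move=> /or4P[|||/orP[]] /eqP[-> -> ->]; vm_compute.
Qed.

(** * Growth of caterpillar weights and the strict gap at all sizes *)

(** Adding a leaf at the root is a competitor of weight [h k * G k]. It is the caterpillar itself
    along the spine, and loses to the balanced tree at special sizes by [weight_gap_bal] with
    [i = 1]; at size 2 the symmetry factor gives the slack. *)
Lemma weight_growth k : (0 < k)%N -> h k * G k <= G k.+1.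
Proof.
case: k => [//|[|k]] _.
  by rewrite /= /harm big_nat1 /=; lra.
have [ks|ks] := boolP (k.+3 \in special); last first.
  by rewrite (weight_spine _ ks).
have k1 : k.+2.+1 = (1 + k.+2)%N by [].
rewrite (weight_bal ks) k1 -mulrA mulrCA ler_pM2l ?harm_gt0//.
rewrite -[leLHS]mul1r -[1]/(G 1) ltW//.
by apply: weight_gap_bal; rewrite // -k1.
Qed.

Lemma weight_growth_prod j n : (0 < j)%N ->
  (\prod_(l < n) h (j + l)) * G j <= G (j + n).
Proof.
move=> j0; elim: n => [|n IH]; first by rewrite big_ord0 mul1r addn0.
rewrite big_ord_recr/= mulrAC mulrC addnS.
apply: le_trans (weight_growth _); last by lia.
by rewrite ler_pM2l// harm_gt0//; lia.
Qed.

(* G(j + 1) / G(j) >= h_j >= h_(i-1) = G(i) / G(i - 1) for i <= j, i not special. *)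
Lemma weight_shift s n j : (1 < s)%N -> (s + n <= j)%N ->
  (forall l, (0 < l <= n)%N -> (s + l)%N \notin special) ->
  G (s + n) * G j <= G s * G (j + n).
Proof.
move=> s1; elim: n j => [|n IH] j snj ns; first by rewrite !addn0.
rewrite addnS -(addSnnS j); apply: le_trans (IH _ _ _); last 2 first.
- lia.
- by move=> l ln; apply: ns; lia.
rewrite weight_spine; last 2 first.
- lia.
- by rewrite -addnS; apply: ns; lia.
rewrite mulrAC [leRHS]mulrC ler_pM2r ?weight_gt0//.
apply: le_trans (weight_growth _); last by lia.
by rewrite ler_pM2r ?weight_gt0// harm_le//; lia.
Qed.

(** First [n] leaves move to the larger side, shrinking the smaller one to the anchor [s]. Then
    [c * G s] loses to the [s - 1] harmonic factors gained by growing the larger side from [j + n]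
    to [j + n + s - 1]. *)
Lemma weight_gap_anchor c s j0 n j : (1 < s)%N -> (s + n <= j)%N ->
  (forall l, (0 < l <= n)%N -> (s + l)%N \notin special) ->
  (0 < j0 <= j + n)%N ->
  (c, s, j0) \in anchors ->
  c%:R * (G (s + n) * G j) < G (s + n + j).-1.
Proof.
move=> s1 snj ns j0j /weight_anchor anchor.
apply: le_lt_trans (_ : c%:R * (G s * G (j + n)) < _).
  by rewrite ler_wpM2l// weight_shift.
rewrite mulrA.
have -> : (s + n + j).-1 = (j + n + s.-1)%N by lia.
apply: lt_le_trans (weight_growth_prod _ _); last by lia.
rewrite ltr_pM2r ?weight_gt0//; apply: lt_le_trans anchor _.
apply: ler_prod => l _; rewrite harm_ge0/= harm_le//; lia.
Qed.

Lemma weight_gap i j : (1 < i <= j)%N -> (i + j)%N \notin special ->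
  (sym i j)%:R * (G i * G j) < G (i + j).-1.
Proof.
move=> ij ks.
have [k16|k17] := leqP (i + j) 16; first exact: weight_gap_small.
have symW c : (1 <= c)%N -> (i == j -> c = 2)%N ->
    c%:R * (G i * G j) < G (i + j).-1 ->
    (sym i j)%:R * (G i * G j) < G (i + j).-1.
  move=> c1 c2; apply: le_lt_trans.
  rewrite ler_pM2r ?mulr_gt0 ?weight_gt0// ler_nat /sym.
  by case: eqP => // /eqP/c2 ->.
have anchor c s j0 : (1 < s <= i)%N -> (0 < j0 <= j + (i - s))%N ->
    (forall l, (s < l <= i)%N -> l \notin special) ->
    (c, s, j0) \in anchors ->
    c%:R * (G i * G j) < G (i + j).-1.
  move=> si j0j ns; rewrite -(@subnKC s i); last by lia.
  apply: weight_gap_anchor => //; try lia.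
  by move=> l ln; apply: ns; lia.
have far s l : (forall m, (s < m <= l)%N -> m \notin special) ->
    (i <= l)%N -> forall m, (s < m <= i)%N -> m \notin special.
  by move=> ns il m mi; apply: ns; lia.
(* The anchor is the largest of 2, 4, 8, 16 not exceeding [i]. Since [i + j >= 17], equality [i = j]
   forces [i >= 9], so only there is [c = 2] needed. The value 8 is treated apart from 9 to 15: its
   final size may be only 9, but without symmetry. *)
have [i3|i4] := leqP i 3.
  apply: (@symW 1) => //; first lia.
  apply: (@anchor _ 2 15) => //; try lia.
  by apply: far i3 => m; rewrite !inE; lia.
have [i7|i8] := leqP i 7.
  apply: (@symW 1) => //; first lia.
  apply: (@anchor _ 4 13) => //; try lia.
  by apply: far i7 => m; rewrite !inE; lia.
have [i15|i16] := leqP i 15; last first.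
  apply: (@symW 2) => //; apply: (@anchor _ 16 16) => //; try lia.
  by move=> m; rewrite !inE; lia.
have [ile8|i9] := leqP i 8.
  apply: (@symW 1) => //; first lia.
  by apply: (@anchor _ 8 9) => //; lia.
apply: (@symW 2) => //; apply: (@anchor _ 8 10) => //; try lia.
by apply: far i15 => m; rewrite !inE; lia.
Qed.

(** * Extremality of the caterpillar *)

Lemma mulr_eq_le (a b c d : R) : 0 < a -> 0 < b -> a <= c -> b <= d ->
  a * b = c * d -> a = c /\ b = d.
Proof.
move=> a0 b0 ac bd E; have c0 := lt_le_trans a0 ac.
have bdE : b = d.
  apply/eqP; rewrite eq_le bd/= leNgt; apply/negP => ltbd.
  have : a * b < c * d; last by rewrite E ltxx.
  by apply: le_lt_trans (ler_wpM2r (ltW b0) ac) _; rewrite ltr_pM2l.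
by split => //; apply: (mulIf (lt0r_neq0 b0)); rewrite E bdE.
Qed.

(** The equality case is carried through the strong induction, since uniqueness at the root rests on
    uniqueness for both subtrees. *)
Lemma weight_max T : w T <= G (leaves T) /\
  (w T = G (leaves T) -> tree_iso T (Catu (leaves T))).
Proof.
have [k kE] : exists k, leaves T = k by exists (leaves T).
rewrite kE; elim/ltn_ind: k T kE => k IH [|A B] kE.
  by rewrite -kE.
wlog AB : A B kE / (leaves A <= leaves B)%N.
  move=> H; have [|BA] := leqP (leaves A) (leaves B); first exact: H.
  have -> : w (Node A B) = w (Node B A).
    by rewrite /= tree_iso_sym addnC [w A * _]mulrC.
  have BA' : tree_iso (Node B A) (Node A B) by rewrite /= !tree_iso_refl orbT.
  have [|le eq] := H B A _ (ltnW BA); first by rewrite -kE /= addnC.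
  split=> // /eq; apply: tree_iso_trans.
  by rewrite tree_iso_sym.
have A0 := leaves_gt0 A; have B0 := leaves_gt0 B.
have wA := weight_gt0 R A; have wB := weight_gt0 R B.
rewrite /= in kE.
have [leA eqA] := IH (leaves A) ltac:(lia) A erefl.
have [leB eqB] := IH (leaves B) ltac:(lia) B erefl.
have hk : 0 < h k.-1 by apply: harm_gt0; lia.
have leAB : w A * w B <= G (leaves A) * G (leaves B).
  by apply: ler_pM => //; exact: ltW.
(* A strict inequality makes the equality clause vacuous. *)
have strict (x y : R) (P : Prop) : x < y -> x <= y /\ (x = y -> P).
  by move=> xy; split; [exact: ltW|move=> E; rewrite E ltxx in xy].
have sizes : (leaves A < leaves B)%N -> tree_iso A B = false.
  by move=> ltAB; apply/negP => /tree_iso_leaves E; rewrite E ltnn in ltAB.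
have [ks|ks] := boolP (k \in special).
  rewrite [w (Node A B)]/= kE (weight_bal ks) [Catu k]Catu_bal//.
  move: AB; rewrite leq_eqVlt => /predU1P[ABE|ltAB]; last first.
    apply: strict; rewrite sizes// mul1r -[ltRHS]mulrA [ltRHS]mulrCA ltr_pM2l//.
    apply: le_lt_trans leAB _; rewrite -kE.
    by apply: weight_gap_bal; rewrite ?A0// kE.
  have kA : k./2 = leaves A by lia.
  rewrite kA; rewrite -ABE in leB eqB leAB.
  case: ifPn => isoAB.
    rewrite ler_pM2l ?mulr_gt0//; split => // /mulfI E.
    have {}E := E ltac:(by rewrite mulf_neq0 ?gt_eqF).
    have [EA EB] := mulr_eq_le wA wB leA leB E.
    by rewrite /= eqA// eqB.
  (* Subtrees of equal size that are not isomorphic forfeit the factor 2. *)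
  apply: strict; rewrite mul1r -[ltRHS]mulrA [ltRHS]mulrCA ltr_pM2l//.
  apply: le_lt_trans leAB _.
  by rewrite ltr_pMl ?ltr1n// mulr_gt0 ?weight_gt0.
have [A1|A2] := leqP (leaves A) 1.
  case: A kE AB A0 wA IH leA eqA leAB sizes A1 => [|a a'] /=; last first.
    by have := leaves_gt0 a; have := leaves_gt0 a'; lia.
  move=> kE _ _ _ IH _ _ _ _ _.
  (* Size 2 is separate: both subtrees are leaves, so the root is symmetric and the spine formula
     does not apply. *)
  have [B1|B2] := leqP (leaves B) 1.
    case: B kE B0 B1 {IH leB eqB wB strict} => [|b b'] /=; last first.
      by have := leaves_gt0 b; have := leaves_gt0 b'; lia.
    by move=> <- _ _; rewrite /= mul1r.
  have kB : k = (leaves B).+1 by lia.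
  have -> : (if B is Leaf then true else false) = false by case: (B) B2.
  rewrite -kE add1n !mul1r.
  rewrite kB in ks.
  rewrite weight_spine// ler_pM2l ?harm_gt0//; split => // /mulfI E.
  have {}E := E ltac:(by rewrite gt_eqF ?harm_gt0).
  by rewrite Catu_spine//= eqB.
apply: strict.
(* Equal sizes do not imply isomorphism, so [sym] only bounds the symmetry factor from above. *)
have symE :
    (if tree_iso A B then 2 else 1) <= (sym (leaves A) (leaves B))%:R :> R.
  rewrite /sym; case: ifPn => [/tree_iso_leaves ->|_]; first by rewrite eqxx.
  by rewrite ler1n; case: ifP.
have -> : G k = h k.-1 * G k.-1.
  have k1 : k = k.-1.+1 by lia.
  by rewrite {1}k1 weight_spine//; [lia|rewrite -k1].
rewrite [w _]/= kE mulrAC mulrC ltr_pM2l//.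
apply: le_lt_trans
  (_ : (sym (leaves A) (leaves B))%:R * (G (leaves A) * G (leaves B)) < _).
  apply: ler_pM => //; first by case: ifP.
  by rewrite ltW// mulr_gt0.
by rewrite -kE; apply: weight_gap; rewrite ?A2// kE.
Qed.

Lemma weight_Catu_prod k : (16 <= k)%N ->
  G k = G 16 * \prod_(17 <= i < k.+1) h i.-1.
Proof.
elim: k => // k IH; rewrite leq_eqVlt => /predU1P[<-|k16].
  by rewrite big_geq// mulr1.
rewrite weight_spine; last 2 first.
- lia.
- by rewrite !inE; lia.
by rewrite IH// [X in _ = _ * X]big_nat_recr// mulrCA [h k * _]mulrC.
Qed.

Lemma Piso_Catu k : (0 < k)%N -> Piso R k (Catu k) = k%:R / G k.
Proof. by move=> k0; rewrite -{1}(leaves_Catu k0) PisoE leaves_Catu. Qed.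

Lemma Piso_min k T : leaves T = k ->
  Piso R k (Catu k) <= Piso R k T /\
  (Piso R k T = Piso R k (Catu k) -> tree_iso T (Catu k)).
Proof.
move=> kE; have k0 : (0 < k)%N by rewrite -kE leaves_gt0.
have [le eq] := weight_max T.
rewrite Piso_Catu// -kE PisoE ler_pM2l ?ltr0n ?leaves_gt0//.
split; first by rewrite lef_pV2 ?posrE ?weight_gt0.
move=> /mulfI E; apply: eq; apply: invr_inj; apply: E.
by rewrite pnatr_eq0 -lt0n leaves_gt0.
Qed.

Lemma pminE k : (0 < k)%N -> pmin R k = Piso R k (Catu k).
Proof.
move=> k0; have [T kE [-> Tmin]] := pmin_attained R k0.
apply/eqP; rewrite eq_le Tmin ?leaves_Catu//=.
by have [] := Piso_min kE.
Qed.

(** * Asymptotics *)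

Lemma ln_leB1 (x : R) : 0 < x -> ln x <= x - 1.
Proof. by move=> x0; rewrite -{1}[x](subrKC 1) le_ln1Dx//; lra. Qed.

(** The concave logarithm lies below its tangent at [x]; no order between [x] and [y] is assumed, so
    both directions of the harmonic estimates follow from it. *)
Lemma lnB_le (x y : R) : 0 < x -> 0 < y -> ln y - ln x <= (y - x) / x.
Proof.
move=> x0 y0; rewrite -ln_div ?posrE//.
apply: le_trans (ln_leB1 _) _; first by rewrite divr_gt0.
by rewrite mulrBl divff// gt_eqF.
Qed.

Lemma ln_le_harm n : ln n.+1%:R <= h n.
Proof.
elim: n => [|n IH]; first by rewrite ln1 /harm big_geq.
rewrite /harm big_nat_recr//= -/(h n).
have := @lnB_le n.+1%:R n.+2%:R (ltr0Sn _ _) (ltr0Sn _ _).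
rewrite -natrB// subSnn mul1r; move: IH.
by move: (ln _) (ln _) (h n) (_^-1) => a b c d; lra.
Qed.

Lemma harm_le_ln n : (0 < n)%N -> h n <= 1 + ln n%:R.
Proof.
elim: n => [//|[|n] IH] _; first by rewrite ln1 /harm big_nat1 invr1 addr0.
rewrite /harm big_nat_recr//= -/(h n.+1).
have := @lnB_le n.+2%:R n.+1%:R (ltr0Sn _ _) (ltr0Sn _ _).
have -> : n.+1%:R - n.+2%:R = -1 :> R by rewrite -opprB -natrB// subSnn.
rewrite mulN1r => H.
by move: (IH isT); move: H; move: (ln _) (ln _) (h _) (_^-1) => a b c d; lra.
Qed.

Local Notation LL k := (ln (ln (k%:R : R))).

Lemma ln_ge1 k : (4 <= k)%N -> 1 <= ln (k%:R : R).
Proof.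
move=> k4; apply: (@le_trans _ _ (ln 4)); last first.
  by rewrite ler_ln ?posrE ?ltr0n ?(ler_nat _ 4)//; lia.
have -> : 4 = 2 * 2 :> R by rewrite -natrM.
rewrite lnM ?posrE//.
have := @lnB_le 2 1 ltac:(lra) ltac:(lra); rewrite ln1; lra.
Qed.

Lemma lnln_ge0 k : (4 <= k)%N -> 0 <= LL k.
Proof. by move=> k4; rewrite ln_ge0// ln_ge1. Qed.

Lemma lnln_gt0 k : (4 < k)%N -> 0 < LL k.
Proof.
move=> k4; rewrite ln_gt0// (le_lt_trans (ln_ge1 (leqnn 4)))//.
by rewrite ltr_ln ?posrE ?ltr0n ?ltr_nat//; lia.
Qed.

(** Each spine step adds [ln (h k)], which lies between [LL k.+1] and [LL k + 1]. The bounds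
    telescope because [LL] varies so slowly that [k%:R * (LL k.+1 - LL k)] stays within 0 and 1. *)
Lemma ln_weight_bounds k : (16 <= k)%N ->
  (k%:R - 16) * LL k - k%:R <= ln (G k) - ln (G 16) <= k%:R * (LL k + 1).
Proof.
elim: k => // k IH; rewrite leq_eqVlt => /predU1P[<-|k16].
  rewrite !subrr mul0r sub0r oppr_le0 ler0n/= mulr_ge0//.
  by rewrite addr_ge0// lnln_ge0.
have {IH} /andP[IHl IHu] := IH k16.
have k0 : 0 < k%:R :> R by rewrite ltr0n; lia.
have l1 : 1 <= ln (k%:R : R) by rewrite ln_ge1//; lia.
have l1' : 1 <= ln (k.+1%:R : R) by rewrite ln_ge1//; lia.
have l0 := lt_le_trans ltr01 l1; have l0' := lt_le_trans ltr01 l1'.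
have hk : 0 < h k by apply: harm_gt0; lia.
have -> : ln (G k.+1) = ln (h k) + ln (G k).
  rewrite weight_spine ?lnM ?posrE ?weight_gt0//; first lia.
  by rewrite !inE; lia.
have low : LL k.+1 <= ln (h k).
  by rewrite ler_ln ?posrE// ln_le_harm.
have up : ln (h k) <= LL k + 1.
  apply: (@le_trans _ _ (ln (1 + ln k%:R))).
    by rewrite ler_ln ?posrE ?addr_gt0// harm_le_ln//; lia.
  have := lnB_le l0 (addr_gt0 ltr01 l0); rewrite addrK => H.
  have : 1 / ln k%:R <= 1 :> R by rewrite ler_pdivrMr// mul1r.
  lra.
have mono : LL k <= LL k.+1.
  by rewrite ler_ln ?posrE// ler_ln ?posrE ?ltr0Sn// ler_nat.
have incr : k%:R * (LL k.+1 - LL k) <= 1.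
  apply: (@le_trans _ _ (k%:R * (ln k.+1%:R - ln k%:R))).
    rewrite ler_pM2l//; apply: le_trans (lnB_le l0 l0') _.
    rewrite ler_pdivrMr// ler_peMr// subr_ge0.
    by rewrite ler_ln ?posrE ?ltr0Sn// ler_nat.
  rewrite -ler_pdivlMl//; apply: le_trans (lnB_le k0 (ltr0Sn R k)) _.
  by rewrite -natrB// subSnn mulrC.
have mono' : 0 <= k%:R * (LL k.+1 - LL k) by rewrite mulr_ge0// ?subr_ge0// ltW.
move: mono mono' incr low up IHl IHu.
move: (LL k.+1) (LL k) (ln (h k)) (ln (G k)) (ln (G 16)) => y z u v g.
rewrite -natr1 => *; apply/andP; split; lra.
Qed.

Lemma Piso_Catu_asymptotics : exists eps : nat -> R,
  (eps n @[n --> \oo] --> (0 : R)) /\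
  forall k : nat, (17 <= k)%N ->
    Piso R k (Catu k) = expR (- ((1 + eps k) * k%:R * ln (ln k%:R))).
Proof.
pose N k := - ln (Piso R k (Catu k)).
(* Solving the required identity for [eps k] makes the formula exact; only convergence to 0 carries
   content. *)
exists (fun k => N k / (k%:R * LL k) - 1); split; last first.
  move=> k k17.
  have LL0 : 0 < LL k by apply: lnln_gt0; lia.
  have k0 : 0 < k%:R :> R by rewrite ltr0n; lia.
  have -> : (1 + (N k / (k%:R * LL k) - 1)) * k%:R * LL k = N k.
    by field; rewrite !gt_eqF.
  by rewrite /N opprK lnK// posrE Piso_Catu ?divr_gt0 ?weight_gt0//; lia.
(* Chosen so that [N k] differs from [k%:R * LL k] by at most [C * k%:R]: 16 pays for [16 * LL k],
   and 1 each for the linear error term and for [ln k%:R]. *)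
pose C := `|ln (G 16)| + 18.
have C0 : 0 < C by rewrite ltr_wpDl.
have bound k : (17 <= k)%N -> `|N k / (k%:R * LL k) - 1| <= C / LL k.
  move=> k17.
  have LL0 : 0 < LL k by apply: lnln_gt0; lia.
  have k0 : 0 < k%:R :> R by rewrite ltr0n; lia.
  have k1 : 1 <= k%:R :> R by rewrite ler1n; lia.
  have lnk : 1 <= ln k%:R :> R by rewrite ln_ge1//; lia.
  have lnk' : ln k%:R <= k%:R :> R by apply: le_trans (ln_leB1 k0) _; lra.
  have LLk : LL k <= k%:R.
    apply: le_trans (ln_leB1 _) _; lra.
  have NE : N k = ln (G k) - ln k%:R.
    by rewrite /N Piso_Catu ?ln_div ?posrE ?weight_gt0 ?opprB//; lia.
  have -> : N k / (k%:R * LL k) - 1 = (N k - k%:R * LL k) / (k%:R * LL k).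
    by field; rewrite !gt_eqF.
  have kL : 0 < k%:R * LL k by rewrite mulr_gt0.
  rewrite normrM normfV [X in _ / X]gtr0_norm// ler_pdivrMr//.
  have -> : C / LL k * (k%:R * LL k) = C * k%:R by field; rewrite gt_eqF.
  have /andP[lo up] := ln_weight_bounds (ltnW k17).
  have g1 := ler_norm (ln (G 16)); have g2 := lerNnormlW (lexx `|ln (G 16)|).
  have g3 : `|ln (G 16)| <= `|ln (G 16)| * k%:R by rewrite ler_peMr.
  have lnk0 := le_trans ler01 lnk.
  rewrite NE ler_norml /C mulrDl; move: lo up LLk lnk0 lnk' k1 g1 g2 g3.
  move: k%:R (ln (G 16)) `|_| (ln k%:R) (ln (G k)) (LL k) => x g n l v y *.
  by apply/andP; split; lra.
apply/cvgr0Pnorm_le => e e0; near=> k.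
have k17 : (17 <= k)%N by near: k; exact: nbhs_infty_ge.
apply: le_trans (bound k k17) _.
rewrite ler_pdivrMr ?lnln_gt0//; last lia.
rewrite mulrC -ler_pdivrMr//.
(* Two logarithms turn this threshold into [C / e <= LL k]. *)
have : expR (expR (C / e)) <= k%:R :> R by near: k; exact: nbhs_infty_ger.
have k0 : 0 < k%:R :> R by rewrite ltr0n; lia.
rewrite -ler_ln ?posrE ?expR_gt0// expRK => le1.
rewrite -[leLHS]expRK ler_ln ?posrE ?expR_gt0//.
exact: lt_le_trans (expR_gt0 _) le1.
Unshelve. all: by end_near.
Qed.

End caterpillar.

Theorem lemma2p7 (R : realType) :
  (forall k : nat, (1 <= k)%N ->
     leaves (Catu k) = k /\
     forall T : btree, leaves T = k ->
       Piso R k (Catu k) <= Piso R k T /\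
       (Piso R k T = Piso R k (Catu k) -> tree_iso T (Catu k))) /\
  (forall k : nat, (17 <= k)%N ->
     Piso R k (Catu k) =
       k%:R * pmin R 16 / 16 * \prod_(17 <= i < k.+1) (harm R i.-1)^-1) /\
  (exists eps : nat -> R,
     (eps n @[n --> \oo] --> (0 : R)) /\
     forall k : nat, (17 <= k)%N ->
       Piso R k (Catu k) = expR (- ((1 + eps k) * k%:R * ln (ln k%:R)))).
Proof.
split; [|split; last exact: Piso_Catu_asymptotics].
  by move=> k k1; split; [exact: leaves_Catu|exact: Piso_min].
(* Here [pmin R 16] becomes 16 divided by the weight of [Catu 16], so the 16 cancels. *)
move=> k k17; rewrite pminE// !Piso_Catu//; last lia.
rewrite weight_Catu_prod ?(ltnW k17)// prodfV.
have p0 : \prod_(17 <= i < k.+1) harm R i.-1 != 0.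
  rewrite big_seq prodf_seq_neq0; apply/allP => i; rewrite mem_index_iota => ik.
  by apply/implyP => _; rewrite gt_eqF ?harm_gt0//; lia.
have g0 := lt0r_neq0 (weight_gt0 R (Catu 16)).
by field; rewrite p0 g0.
Qed.
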